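(* Let $I\subset\mathbb{R}$ be an open interval. Let $\gamma_1,\gamma_2:I\to H^1$ be two horizontal unit-speed curves with the same $p$-curvature $k(s)$. Then there exists $g\in PSH(1)$ such that $\gamma_2(s)=g\circ\gamma_1(s)$ for all $s\in I$. In addition, given a smooth function $k:I\to\mathbb{R}$, there exists a horizontal unit-speed curve $\gamma:I\to H^1$ having $k(s)$ as its $p$-curvature.
   Context: $H^1$ is $\mathbb{R}^3$ with group law $(x_1,y_1,z_1)\circ(x_2,y_2,z_2)=(x_1+x_2,\,y_1+y_2,\,z_1+z_2+y_1x_2-x_1y_2)$ and left invariant vector fields $\mathring e_1=\partial_x+y\,\partial_z$, $\mathring e_2=\partial_y-x\,\partial_z$, $T=\partial_z$. The contact form is $\theta_0=dz+x\,dy-y\,dx$, the contact bundle is $\xi_0=\ker\theta_0=\mathrm{span}(\mathring e_1,\mathring e_2)$, and $J_0:\xi_0\to\xi_0$ is given by $J_0\mathring e_1=\mathring e_2$, $J_0\mathring e_2=-\mathring e_1$. $\langle\cdot,\cdot\rangle$ is the Riemannian metric on $H^1$ for which $\mathring e_1,\mathring e_2,T$ are orthonormal. $PSH(1)$ is the group of pseudohermitian transformations (Heisenberg rigid motions): diffeomorphisms $\Phi$ of $H^1$ with $\Phi^*\theta_0=\theta_0$ and $\Phi_*J_0=J_0\Phi_*$ on $\xi_0$. All curves are smooth. A curve $\gamma$ is horizontal if $\gamma'(s)\in\xi_0$ for all $s$, and unit-speed if $|\gamma'(s)|=1$ for all $s$. For a horizontal unit-speed curve put $X(s)=\gamma'(s)$,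 $Y(s)=J_0X(s)$; the $p$-curvature is $k(s)=\langle\frac{dX}{ds}(s),Y(s)\rangle$, where $\frac{dX}{ds}$ is the componentwise derivative of $X$ viewed as an $\mathbb{R}^3$-valued function (components with respect to $\partial_x,\partial_y,\partial_z$), regarded as a tangent vector at $\gamma(s)$. *)

(* Defs.v *)
From HB Require Import structures.
From mathcomp Require Import all_boot all_order all_algebra.
From mathcomp Require Import all_classical all_reals all_analysis.
From mathcomp Require Import ring.

Set Implicit Arguments.
Unset Strict Implicit.
Unset Printing Implicit Defensive.

Import Order.TTheory GRing.Theory Num.Theory.
Import numFieldNormedType.Exports.

Local Open Scope ring_scope.
Local Open Scope classical_set_scope.


(* H^1 is R^3 = 'rV[R]_3.  A tangent vector at p is the row of its components
   in the basis (d/dx, d/dy, d/dz), so all the notions below that depend on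
   the base point take it as an explicit first argument. *)

Section Heisenberg.
Variable R : realType.
Implicit Types (p u v : 'rV[R]_3) (I : set R) (c : R -> 'rV[R]_3).

Definition vec3 (x y z : R) : 'rV[R]_3 := \row_(i < 3) [:: x; y; z]`_i.

Definition cx v : R := v ord0 (@Ordinal 3 0 isT).
Definition cy v : R := v ord0 (@Ordinal 3 1 isT).
Definition cz v : R := v ord0 (@Ordinal 3 2 isT).

Definition e1 p : 'rV[R]_3 := vec3 1 0 (cy p).
Definition e2 p : 'rV[R]_3 := vec3 0 1 (- cx p).
Definition Tvec p : 'rV[R]_3 := vec3 0 0 1.

(* theta_0 = dz + x dy - y dx *)
Definition theta0 p v : R := cz v + cx p * cy v - cy p * cx v.

Definition in_xi0 p v : Prop := theta0 p v = 0.

(* J_0 (a e1 + b e2) = a e2 - b e1.  The horizontal vector with coordinates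
   (a, b) has x- and y-components a and b (see [frame_decomp]).  J_0 is only
   meaningful on xi_0; here it is extended by J_0 T = 0, and it is only ever
   applied to horizontal vectors. *)
Definition J0 p v : 'rV[R]_3 := cx v *: e2 p - cy v *: e1 p.

(* The coordinates of v in the frame (e1, e2, T) at p are
   (cx v, cy v, theta0 p v) (see [frame_decomp]); the metric making the frame
   orthonormal is thus the following. *)
Definition metric p u v : R :=
  cx u * cx v + cy u * cy v + theta0 p u * theta0 p v.

Definition mnorm p v : R := Num.sqrt (metric p v v).

Lemma frame_decomp p v :
  v = cx v *: e1 p + cy v *: e2 p + theta0 p v *: Tvec p.
Proof.
apply/rowP => i; rewrite !mxE /theta0 /cx /cy /cz.
by case: i => [[|[|[|//]]] Hi] /=; rewrite (ord1 0) ?mulr1 ?mulr0 ?addr0 ?add0r;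
  rewrite (bool_irrelevance Hi isT) //; ring.
Qed.

Lemma metric_frame p :
  [/\ metric p (e1 p) (e1 p) = 1, metric p (e2 p) (e2 p) = 1,
      metric p (Tvec p) (Tvec p) = 1 &
      [/\ metric p (e1 p) (e2 p) = 0, metric p (e1 p) (Tvec p) = 0
        & metric p (e2 p) (Tvec p) = 0]].
Proof. by split; last split; rewrite /metric /theta0 /cx /cy /cz !mxE /= ?/cx ?/cy; ring. Qed.

Lemma xi0_frame p : in_xi0 p (e1 p) /\ in_xi0 p (e2 p).
Proof. by split; rewrite /in_xi0 /theta0 /cx /cy /cz !mxE /= ?/cx ?/cy; ring. Qed.

Lemma J0_frame p : J0 p (e1 p) = e2 p /\ J0 p (e2 p) = - e1 p.
Proof.
by rewrite /J0 /e1 /e2 /cx /cy !mxE /= !scale1r !scale0r subr0 sub0r.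
Qed.

Fixpoint Ck (k : nat) (F : 'rV[R]_3 -> 'rV[R]_3) : Prop :=
  match k with
  | 0 => continuous F
  | k'.+1 => (forall p, differentiable F p) /\
             (forall i : 'I_3, Ck k' ('D_(delta_mx 0 i) F))
  end.

Definition smooth_map (F : 'rV[R]_3 -> 'rV[R]_3) : Prop := forall k, Ck k F.

Definition diffeomorphism (F : 'rV[R]_3 -> 'rV[R]_3) : Prop :=
  exists G : 'rV[R]_3 -> 'rV[R]_3,
    [/\ cancel F G, cancel G F, smooth_map F & smooth_map G].

Definition PSH1 (F : 'rV[R]_3 -> 'rV[R]_3) : Prop :=
  [/\ diffeomorphism F,
      forall p v, theta0 (F p) ('d F p v) = theta0 p v &
      forall p v, in_xi0 p v -> 'd F p (J0 p v) = J0 (F p) ('d F p v)].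

(* Functions on an open set I are represented by functions on R, of which
   only the values on I matter. *)
Definition smooth_on (V : normedModType R) I (f : R -> V) : Prop :=
  forall (n : nat) (s : R), I s -> derivable (derive1n n f) s 1.

Definition horizontal I c : Prop := forall s, I s -> in_xi0 (c s) (derive1 c s).

Definition unit_speed I c : Prop := forall s, I s -> mnorm (c s) (derive1 c s) = 1.

Definition horizontal_unit_speed_curve I c : Prop :=
  [/\ smooth_on I c, horizontal I c & unit_speed I c].

(* <dX/ds, Y> at c(s), with X = c' and Y = J_0 X *)
Definition p_curvature c (s : R) : R :=
  metric (c s) (derive1 (derive1 c) s) (J0 (c s) (derive1 c s)).

End Heisenberg.

(* Main.v *)
(* The Frenet equations x'' = - k y', y'' = k x' of a horizontal unit-speed
   curve say that its velocity, projected to the xy-plane, turns at speed k.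
   For two curves with the same k the planar velocities hence differ by a
   constant rotation, whose cosine C and sine S are their dot product and
   determinant; the curves then agree up to this rotation and a left
   translation, the z-components being fixed by horizontality.  Conversely, the
   curve with curvature k is obtained by successive primitives: theta of k,
   x and y of cos theta and sin theta, and z of y x' - x y'. *)
Require Import Defs.
From HB Require Import structures.
From mathcomp Require Import all_boot all_order all_algebra.
From mathcomp Require Import all_classical all_reals all_analysis.
From mathcomp Require Import ring lra.
Import Order.TTheory GRing.Theory Num.Theory.
Import numFieldNormedType.Exports.
Local Open Scope classical_set_scope.
Local Open Scope ring_scope.

(** * Smooth functions on an open set: calculus rules at every finite order *)

Section Smoothness.
Context {R : realType} (I : set R) (I_open : open I).

Lemma open_near s : I s -> \forall t \near s, I t.
Proof. by move=> Is; apply: open_nbhs_nbhs. Qed.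

Lemma eq_on_derive1 (V : normedModType R) (f g : R -> V) :
  (forall s, I s -> f s = g s) -> forall s, I s -> derive1 f s = derive1 g s.
Proof.
move=> fg s Is; rewrite !derive1E; apply: near_eq_derive.
by apply: filterS (open_near s Is) => t; exact: fg.
Qed.

(** A finite-order form of smoothness, so that closure properties can be proved by induction on [n].
    Order [n] grants [n.+1] successive derivatives, since [derive1n n f] must itself be
    derivable. *)
Definition smooth_upto {V : normedModType R} n (f : R -> V) : Prop :=
  forall m s, (m <= n)%N -> I s -> derivable (derive1n m f) s 1.

Lemma smooth_onP {V : normedModType R} (f : R -> V) :
  smooth_on I f <-> forall n, smooth_upto n f.
Proof. by split=> [fs n m s _|fs n s]; [exact: fs|exact: (fs n)]. Qed.

Lemma smooth_upto_eq {V : normedModType R} n (f g : R -> V) :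
  (forall s, I s -> f s = g s) -> smooth_upto n f -> smooth_upto n g.
Proof.
move=> fg fn m s mn Is.
suff eqm t : I t -> derive1n m f t = derive1n m g t.
  apply: near_eq_derivable (fn m s mn Is).
  exact: filterS (open_near s Is).
elim: {mn} m t => [|m IH] t It; first exact: fg.
exact: eq_on_derive1.
Qed.

Lemma smooth_uptoS {V : normedModType R} n (f : R -> V) :
  smooth_upto n.+1 f <->
  (forall s, I s -> derivable f s 1) /\ smooth_upto n (derive1 f).
Proof.
split=> [fn|[f0 fn] [|m] s mn Is]; last 2 first.
- exact: f0.
- by rewrite derive1Sn; exact: fn.
split=> [s|m s mn Is]; first exact: (fn 0%N).
by rewrite -derive1Sn; exact: fn.
Qed.

Lemma smooth_uptoW {V : normedModType R} n (f : R -> V) :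
  smooth_upto n.+1 f -> smooth_upto n f.
Proof. by move=> fn m s mn; apply: fn; exact: leqW. Qed.

(** The inductive step of the closure proofs for scalar functions: a formula for the derivative
    valid on [I] is enough, since [I] is open. *)
Lemma smooth_upto_derive n (f df : R -> R) :
  (forall s, I s -> is_derive s 1 f (df s)) ->
  smooth_upto n df -> smooth_upto n.+1 f.
Proof.
move=> fdf dfn; apply/smooth_uptoS; split=> [s /fdf[]//|].
apply: smooth_upto_eq dfn => s Is.
by rewrite derive1E; have [_ ->] := fdf s Is.
Qed.

Lemma smooth_on_derive (f df : R -> R) :
  (forall s, I s -> is_derive s 1 f (df s)) ->
  smooth_on I df -> smooth_on I f.
Proof.
move=> fdf /smooth_onP dfs; apply/smooth_onP => n.
exact/smooth_uptoW/(smooth_upto_derive _ _ _ fdf).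
Qed.

Lemma derivable_is_derive1 {V : normedModType R} (f : R -> V) (s : R) :
  derivable f s 1 -> is_derive s 1 f (derive1 f s).
Proof. by move=> fs; rewrite derive1E; exact: derivableP. Qed.

Lemma smooth_uptoD n (f g : R -> R) :
  smooth_upto n f -> smooth_upto n g -> smooth_upto n (fun s => f s + g s).
Proof.
elim: n f g => [|n IH] f g fn gn.
  move=> [|//] s _ Is; apply: derivableD; [exact: (fn 0%N)|exact: (gn 0%N)].
have [f0 f1] := (smooth_uptoS _ _).1 fn; have [g0 g1] := (smooth_uptoS _ _).1 gn.
apply: (smooth_upto_derive _ _ (fun s => derive1 f s + derive1 g s)).
  move=> s Is; apply: is_deriveD; apply: derivable_is_derive1;
  [exact: f0|exact: g0].
exact: (IH _ _ f1 g1).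
Qed.

(** By the Leibniz rule the derivative is a sum of products; [smooth_uptoW] lowers the order of the
    undifferentiated factor to fit the induction. *)
Lemma smooth_uptoM n (f g : R -> R) :
  smooth_upto n f -> smooth_upto n g -> smooth_upto n (fun s => f s * g s).
Proof.
elim: n f g => [|n IH] f g fn gn.
  move=> [|//] s _ Is; apply: derivableM; [exact: (fn 0%N)|exact: (gn 0%N)].
have [f0 f1] := (smooth_uptoS _ _).1 fn; have [g0 g1] := (smooth_uptoS _ _).1 gn.
apply: (smooth_upto_derive _ _ (fun s => f s * derive1 g s + g s * derive1 f s)).
  move=> s Is; apply: is_deriveM; apply: derivable_is_derive1;
  [exact: f0|exact: g0].
apply: smooth_uptoD.
  exact: (IH _ _ (smooth_uptoW _ _ fn) g1).
exact: (IH _ _ (smooth_uptoW _ _ gn) f1).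
Qed.

Lemma smooth_upto_cst n (a : R) : smooth_upto n (fun=> a).
Proof.
elim: n a => [|n IH] a; first by move=> [|//] s _ _; exact: derivable_cst.
apply: (smooth_upto_derive _ _ (fun=> 0)); exact: IH.
Qed.

Lemma smooth_onD (f g : R -> R) :
  smooth_on I f -> smooth_on I g -> smooth_on I (fun s => f s + g s).
Proof.
move=> /smooth_onP fs /smooth_onP gs; apply/smooth_onP => n.
exact: smooth_uptoD.
Qed.

Lemma smooth_onM (f g : R -> R) :
  smooth_on I f -> smooth_on I g -> smooth_on I (fun s => f s * g s).
Proof.
move=> /smooth_onP fs /smooth_onP gs; apply/smooth_onP => n.
exact: smooth_uptoM.
Qed.

Lemma smooth_on_cst (a : R) : smooth_on I (fun=> a).
Proof. by apply/smooth_onP => n; exact: smooth_upto_cst. Qed.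

Lemma smooth_onN (f : R -> R) : smooth_on I f -> smooth_on I (fun s => - f s).
Proof.
move=> fs; under eq_fun do rewrite -mulN1r.
exact: (smooth_onM _ _ (smooth_on_cst _) fs).
Qed.

Lemma is_derive_sin_comp (theta k : R -> R) (s : R) :
  is_derive s 1 theta (k s) ->
  is_derive s 1 (fun t => sin (theta t)) (cos (theta s) * k s).
Proof. by move=> ?; exact: is_derive1_comp. Qed.

Lemma is_derive_cos_comp (theta k : R -> R) (s : R) :
  is_derive s 1 theta (k s) ->
  is_derive s 1 (fun t => cos (theta t)) (- sin (theta s) * k s).
Proof. by move=> ?; exact: is_derive1_comp. Qed.

Lemma smooth_on_cos_sin (theta : R -> R) : smooth_on I theta ->
  smooth_on I (fun s => cos (theta s)) /\ smooth_on I (fun s => sin (theta s)).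
Proof.
move=> ts.
(* Each of cos and sin occurs in the derivative of the other, so a single induction carries both. *)
suff H n : smooth_upto n (fun s => cos (theta s)) /\
           smooth_upto n (fun s => sin (theta s)).
  by split; apply/smooth_onP => n; case: (H n).
have td s : I s -> is_derive s 1 theta (derive1 theta s).
  by move=> Is; apply: derivable_is_derive1; exact: (ts 0%N).
elim: n => [|n [IHc IHs]].
  split=> -[|//] s _ /td {}td /=.
    by have [] := is_derive_cos_comp _ _ _ td.
  by have [] := is_derive_sin_comp _ _ _ td.
have [_ t1] := (smooth_uptoS n theta).1 ((smooth_onP _).1 ts n.+1).
split.
  apply: (smooth_upto_derive _ _ _ (fun s Is => is_derive_cos_comp _ _ _ (td s Is))).
  apply: (smooth_uptoM _ _ _ _ t1).
  apply: (smooth_upto_eq _ (fun s => -1 * sin (theta s))).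
    by move=> s _; rewrite mulN1r.
  exact: (smooth_uptoM _ _ _ (smooth_upto_cst _ _) IHs).
apply: (smooth_upto_derive _ _ _ (fun s Is => is_derive_sin_comp _ _ _ (td s Is))).
exact: (smooth_uptoM _ _ _ IHc t1).
Qed.

Lemma derive1_mx m n (c : R -> 'M[R]_(m, n)) s : derivable c s 1 ->
  derive1 c s = \matrix_(i, j) derive1 (fun t => c t i j) s.
Proof.
move=> cs; rewrite (derive1E c) (derive_mx cs).
by apply/matrixP => i j; rewrite [LHS]mxE [RHS]mxE derive1E.
Qed.

Lemma smooth_on_mx m n (c : R -> 'M[R]_(m, n)) :
  (forall i j, smooth_on I (fun s => c s i j)) -> smooth_on I c.
Proof.
move=> cs; apply/smooth_onP => N.
have {cs} cs i j : smooth_upto N (fun s => c s i j).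
  exact: ((smooth_onP _).1 (cs i j) N).
elim: N c cs => [|N IH] c cs.
  by move=> [|//] s _ Is; apply/derivable_mxP => i j; exact: (cs i j 0%N).
have c0 s : I s -> derivable c s 1.
  by move=> Is; apply/derivable_mxP => i j; exact: (cs i j 0%N).
apply/smooth_uptoS; split=> //; apply: IH => i j.
have [_] := (smooth_uptoS _ _).1 (cs i j).
by apply: smooth_upto_eq => s Is; rewrite derive1_mx ?mxE//; exact: c0.
Qed.

End Smoothness.

(** * Calculus on an open interval: vanishing derivatives and primitives *)

Section OpenInterval.
Context {R : realType} (I : set R) (I_open : open I) (I_interval : is_interval I).

Lemma interval_segment a b t : I a -> I b -> a <= t <= b -> I t.
Proof. by move=> Ia Ib; exact: (I_interval a b). Qed.

(** Mean value theorem on the segment between the two points, which lies in [I] because [I] is an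
    interval. *)
Lemma derive0_cst_on (f : R -> R) :
  (forall s, I s -> is_derive s 1 f 0) -> forall s t, I s -> I t -> f s = f t.
Proof.
move=> fd s t; wlog st : s t / s <= t => [H Is It|Is It].
  by case: (leP s t) => [/H|/ltW /H] ->.
have sub u : u \in `[s, t] -> I u.
  by rewrite in_itv => /(interval_segment _ _ _ Is It).
have sub' u : u \in `]s, t[ -> is_derive u 1 f 0.
  by move=> /subset_itv_oo_cc /sub /fd.
have [|c _] := MVT_segment st sub'; last first.
  by rewrite mul0r => /eqP; rewrite subr_eq0 => /eqP ->.
apply: derivable_within_continuous => u /sub /fd[]//.
Qed.

Lemma eq_derive_on (f g df dg : R -> R) :
  (forall s, I s -> is_derive s 1 f (df s)) ->
  (forall s, I s -> is_derive s 1 g (dg s)) ->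
  (forall s, I s -> df s = dg s) ->
  forall s t, I s -> I t -> f s - g s = f t - g t.
Proof.
move=> fd gd dfg s t Is It.
apply: (derive0_cst_on (fun u => f u - g u)) => // u Iu.
rewrite -(subrr (df u)) {2}dfg//; apply: is_deriveB; [exact: fd|exact: gd].
Qed.

(** Together with [exists_gt_on], this supplies the room around a point that the fundamental theorem
    of calculus asks for. *)
Lemma exists_lt_on s : I s -> exists2 a, I a & a < s.
Proof.
move=> Is; have := open_near I I_open s Is.
rewrite -near_nbhs => /nbhs_ballP[e /= e0 eI].
exists (s - e / 2); last by rewrite ltrBlDr ltrDl divr_gt0.
apply: eI; rewrite /ball/= opprB addrC subrK gtr0_norm ?divr_gt0//.
by rewrite ltr_pdivrMr// ltr_pMr// ltr1n.
Qed.

Lemma exists_gt_on s : I s -> exists2 a, I a & s < a.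
Proof.
move=> Is; have := open_near I I_open s Is.
rewrite -near_nbhs => /nbhs_ballP[e /= e0 eI].
exists (s + e / 2); last by rewrite ltrDl divr_gt0.
apply: eI; rewrite /ball/= opprD addrA subrr sub0r normrN gtr0_norm ?divr_gt0//.
by rewrite ltr_pdivrMr// ltr_pMr// ltr1n.
Qed.

Notation mu := (@lebesgue_measure R).

(** The primitive is the oriented integral from a base point [s0]. Near each point it differs by a
    constant from an integral with a lower endpoint further left, to which the fundamental theorem
    of calculus applies. *)
Lemma exists_primitive_on (f : R -> R) :
  (forall s, I s -> {for s, continuous f}) ->
  exists F : R -> R, forall s, I s -> is_derive s 1 F (f s).
Proof.
move=> fc; have [[s0 Is0]|I0] := pselect (exists s, I s); last first.
  by exists f => s Is; case: I0; exists s.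
pose P a x := (\int[mu]_(t in [set` `[a, x]]) f t)%R.
have intf a b : I a -> I b -> mu.-integrable `[a, b] (EFin \o f).
  move=> Ia Ib; apply: continuous_compact_integrable; first exact: segment_compact.
  apply: continuous_in_subspaceT => u; rewrite inE/= in_itv/=.
  by move=> /(interval_segment _ _ _ Ia Ib) /fc.
(* [P a x] is zero when [x < a], the domain being empty, so points left of [s0] take minus the
   integral from [s] to [s0]. *)
pose F s := if s0 <= s then P s0 s else - P s s0.
have PB a b c : I a -> I c -> a <= b <= c -> P a c - P a b = P b c.
  move=> Ia Ic /andP[ab bc].
  have Ib : I b by apply: (interval_segment a c) => //; rewrite ab.
  rewrite /P Rintegral_itvB ?bnd_simp//; last exact: intf.
  rewrite Rintegral_itv_obnd_cbnd//.
  by apply: integrableS (intf b c Ib Ic) => //; exact: subset_itv_oc_cc.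
have FP a s : I a -> I s -> a <= s0 -> a <= s -> F s = P a s - P a s0.
  move=> Ia Is as0 as_; rewrite /F; case: leP => s0s.
    by rewrite PB// as0.
  by rewrite -(PB a) ?opprB// as_ ltW.
exists F => s Is.
(* With [a] left of both [s] and [s0], [F] is [P a] minus a constant on a whole neighbourhood of
   [s]. *)
have [a Ia] : exists2 a, I a & a < Num.min s s0.
  by rewrite /Num.min; case: ifP => _; exact: exists_lt_on.
rewrite lt_min => /andP[as_ as0].
have [b Ib sb] := exists_gt_on s Is.
have [Pd PE] : derivable (P a) s 1 /\ derive1 (P a) s = f s.
  exact: (continuous_FTC1_closed sb (intf a b Ia Ib) as_ (fc s Is)).
apply: (@near_eq_is_derive _ _ _ (fun t => P a t - P a s0)).
  near=> t; apply/esym/FP => //; first by near: t; exact: open_near.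
    exact: ltW.
  by near: t; apply: filterS (open_near _ (@open_gt R a) s as_) => t; exact: ltW.
rewrite -PE -[derive1 _ _]subr0; apply: is_deriveB.
exact: derivable_is_derive1.
Unshelve. all: by end_near. Qed.

End OpenInterval.

(** * Coordinates of tangent vectors and curves *)

Section Coordinates.
Context {R : realType}.
Implicit Types (p v : 'rV[R]_3) (x y z : R -> R) (c : R -> 'rV[R]_3).

Lemma cx_vec3 (a b d : R) : cx (vec3 a b d) = a. Proof. by rewrite /cx mxE. Qed.
Lemma cy_vec3 (a b d : R) : cy (vec3 a b d) = b. Proof. by rewrite /cy mxE. Qed.
Lemma cz_vec3 (a b d : R) : cz (vec3 a b d) = d. Proof. by rewrite /cz mxE. Qed.
Definition vec3E := (cx_vec3, cy_vec3, cz_vec3).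

Lemma vec3_coords p : vec3 (cx p) (cy p) (cz p) = p.
Proof.
apply/rowP => -[[|[|[|//]]] i3]; rewrite mxE /cx /cy /cz /=;
  by congr (p _ _); exact/val_inj.
Qed.

Lemma J0E p v :
  J0 p v = vec3 (- cy v) (cx v) (- (cx p * cx v + cy p * cy v)).
Proof.
by apply/rowP => -[[|[|[|//]]] i3]; rewrite /J0 !mxE /=; ring.
Qed.

Lemma is_derive_coord c (s : R) i : derivable c s 1 ->
  is_derive s 1 (fun t => c t ord0 i) (derive1 c s ord0 i).
Proof.
move=> cs; rewrite derive1_mx// mxE; apply: derivable_is_derive1.
exact: ((derivable_mxP _ _ _).1 cs).
Qed.

(** Reduces a statement about all entries of a curve to its three coordinate functions; [P] also
    sees the index, so that it can compare an entry with that of a fixed vector. *)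
Lemma vec3_entry_ind (P : 'I_3 -> (R -> R) -> Prop) x y z (j : 'I_1) :
  P (@Ordinal 3 0 isT) x -> P (@Ordinal 3 1 isT) y -> P (@Ordinal 3 2 isT) z ->
  forall i, P i (fun t => vec3 (x t) (y t) (z t) j i).
Proof.
move=> Px Py Pz [[|[|[|//]]] i3]; rewrite (bool_irrelevance i3 isT).
- by rewrite (_ : (fun t => _) = x)//; apply/funext => t; rewrite mxE.
- by rewrite (_ : (fun t => _) = y)//; apply/funext => t; rewrite mxE.
- by rewrite (_ : (fun t => _) = z)//; apply/funext => t; rewrite mxE.
Qed.

Lemma derive1_vec3 x y z (s dx dy dz : R) :
  is_derive s 1 x dx -> is_derive s 1 y dy -> is_derive s 1 z dz ->
  derive1 (fun t => vec3 (x t) (y t) (z t)) s = vec3 dx dy dz.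
Proof.
move=> [xs <-] [ys <-] [zs <-].
have cs : derivable (fun t => vec3 (x t) (y t) (z t)) s 1.
  have E j := vec3_entry_ind (fun _ f => derivable f s 1) _ _ _ j xs ys zs.
  apply/derivable_mxP => j i.
  exact: E.
rewrite derive1_mx//; apply/rowP => i; rewrite [LHS]mxE; move: i.
apply: (vec3_entry_ind (fun i f => derive1 f s = vec3 _ _ _ ord0 i));
  by rewrite mxE derive1E.
Qed.

Lemma smooth_on_vec3 (I : set R) x y z : open I ->
  smooth_on I x -> smooth_on I y -> smooth_on I z ->
  smooth_on I (fun t => vec3 (x t) (y t) (z t)).
Proof.
move=> Io xs ys zs; apply: smooth_on_mx => [//|j i].
have E := vec3_entry_ind (fun _ f => smooth_on I f) _ _ _ j xs ys zs.
exact: E.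
Qed.

End Coordinates.

(** * Rotations and left translations as pseudohermitian transformations *)

Section Motion.
Context {R : realType}.

Lemma mulmxr_differentiable m n (M : 'M[R]_(m, n)) (p : 'rV[R]_m) :
  differentiable (mulmxr M : 'rV[R]_m -> 'rV[R]_n) p.
Proof.
(* The product is a finite sum of coordinate functions times fixed rows. *)
rewrite (_ : (mulmxr M : _ -> _) =
    \sum_(i < m) (fun q : 'rV[R]_m => q ord0 i *: row i M)).
  apply: differentiable_sum => i; apply: differentiableZl.
  exact: differentiable_coord.
by apply/funext => q; rewrite fct_sumE /= mulmx_sum_row.
Qed.

Section Affine.
Variables (M : 'M[R]_3) (t : 'rV[R]_3).
Let F (p : 'rV[R]_3) : 'rV[R]_3 := p *m M + t.

Lemma affine_is_diff p : is_diff p F (mulmxr M).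
Proof.
have dM : is_diff p (mulmxr M) (mulmxr M).
  apply: DiffDef; first exact: mulmxr_differentiable.
  apply: diff_lin => q; apply: differentiable_continuous.
  exact: mulmxr_differentiable.
have -> : F = mulmxr M \+ cst t by [].
by rewrite -[X in is_diff _ _ X]addr0; exact: is_diffD.
Qed.

Lemma Ck_cst k (a : 'rV[R]_3) : Ck k (fun=> a).
Proof.
elim: k a => [|k IH] a; first exact: cst_continuous.
split=> [p|i]; first exact: differentiable_cst.
rewrite (_ : 'D_(delta_mx 0 i) (fun=> a) = fun=> 0); first exact: IH.
by apply/funext => p; exact: derive_cst.
Qed.

(** The partial derivatives of an affine map are constant, and constants are [Ck] of every order. *)
Lemma affine_smooth : smooth_map F.
Proof.
have dF p : differentiable F p by have [] := affine_is_diff p.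
case=> [|k]; first by move=> p; exact: differentiable_continuous.
split=> // i.
rewrite (_ : 'D_(delta_mx 0 i) F = fun=> delta_mx 0 i *m M); first exact: Ck_cst.
by apply/funext => p; rewrite deriveE//; have [_ ->] := affine_is_diff p.
Qed.

End Affine.

(* The rotation of angle arg (C + i S) about the z-axis, followed by the left
   translation by (A, B, D). *)
Definition motion (C S A B D : R) (p : 'rV[R]_3) : 'rV[R]_3 :=
  let x := C * cx p - S * cy p in
  let y := S * cx p + C * cy p in
  vec3 (x + A) (y + B) (cz p + D + B * x - A * y).

(** The linear part of [motion], hence its differential at every point. It acts on row vectors, so
    its rows are the images of d/dx, d/dy and d/dz. *)
Definition motion_mx (C S A B : R) : 'M[R]_3 :=
  \matrix_(i < 3) [:: vec3 C S (B * C - A * S);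
                      vec3 (- S) C (- B * S - A * C);
                      vec3 0 0 1]`_i.

Lemma mulmx_motion C S A B (v : 'rV[R]_3) :
  v *m motion_mx C S A B =
  vec3 (C * cx v - S * cy v) (S * cx v + C * cy v)
    (cz v + B * (C * cx v - S * cy v) - A * (S * cx v + C * cy v)).
Proof.
rewrite -{1}(vec3_coords v); apply/rowP => -[[|[|[|//]]] i3];
  rewrite !mxE !big_ord_recl big_ord0 !mxE /= ?mxE /=; ring.
Qed.

Lemma motionE C S A B D :
  motion C S A B D = fun p => p *m motion_mx C S A B + vec3 A B D.
Proof.
apply/funext => p; rewrite mulmx_motion /motion.
apply/rowP => -[[|[|[|//]]] i3]; rewrite !mxE //=; ring.
Qed.

(** The inverse is again a motion: the opposite rotation, followed by the left translation by the
    rotated-back inverse of (A, B, D). *)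
Lemma motion_cancel C S A B D : C ^+ 2 + S ^+ 2 = 1 ->
  cancel (motion C S A B D)
    (motion C (- S) (- (C * A + S * B)) (S * A - C * B) (- D)).
Proof.
move=> CS p; rewrite -[RHS]vec3_coords /motion !vec3E.
(* Inserting the factor [C ^+ 2 + S ^+ 2] turns the goals into polynomial identities, within reach
   of [ring]. *)
have E x : x = (C ^+ 2 + S ^+ 2) * x by rewrite CS mul1r.
congr vec3.
- rewrite [RHS]E; ring.
- rewrite [RHS]E; ring.
- set x := C * cx p - S * cy p; set y := S * cx p + C * cy p.
  transitivity (cz p + (1 - (C ^+ 2 + S ^+ 2)) * (B * x - A * y)); first ring.
  by rewrite CS subrr mul0r addr0.
Qed.

Lemma motion_smooth C S A B D : smooth_map (motion C S A B D).
Proof. by rewrite motionE; exact: affine_smooth. Qed.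

Lemma motion_diff C S A B D p v :
  'd (motion C S A B D) p v = v *m motion_mx C S A B.
Proof.
by rewrite motionE; have [_ ->] := affine_is_diff (motion_mx C S A B) (vec3 A B D) p.
Qed.

(** The rotation preserves x dy - y dx and commutes with the quarter turn of the plane; the terms in
    [A] and [B] are those of a left translation, which preserves the frame. *)
Lemma motion_PSH1 C S A B D : C ^+ 2 + S ^+ 2 = 1 -> PSH1 (motion C S A B D).
Proof.
move=> CS; split.
- exists (motion C (- S) (- (C * A + S * B)) (S * A - C * B) (- D)).
  split; [exact: motion_cancel| |exact: motion_smooth..].
  have CS' : C ^+ 2 + (- S) ^+ 2 = 1 by rewrite sqrrN.
  (* The other cancellation is the same lemma at the inverse parameters, once inverting them again
     is seen to restore the original ones. *)
  have := motion_cancel C (- S) (- (C * A + S * B)) (S * A - C * B) (- D) CS'.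
  suff -> : motion C (- - S)
      (- (C * - (C * A + S * B) + - S * (S * A - C * B)))
      (- S * - (C * A + S * B) - C * (S * A - C * B)) (- - D) =
    motion C S A B D by [].
  have E x : x = (C ^+ 2 + S ^+ 2) * x by rewrite CS mul1r.
  congr (motion C _ _ _ _); rewrite ?opprK// [RHS]E; ring.
- move=> p v; rewrite motion_diff mulmx_motion /motion /theta0 !vec3E.
  transitivity (cz v + (C ^+ 2 + S ^+ 2) * (cx p * cy v - cy p * cx v)); first ring.
  by rewrite CS mul1r addrA.
- move=> p v _; rewrite !motion_diff !mulmx_motion !J0E /motion !vec3E.
  have E x : x = (C ^+ 2 + S ^+ 2) * x by rewrite CS mul1r.
  congr vec3; [ring|ring|].
  rewrite [cx p * cx v + cy p * cy v]E; ring.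
Qed.

End Motion.

(** * Planar vectors: dot products, determinants and rotations *)

Section PlaneRotations.
Context {R : realType}.

(** A vector orthogonal to the unit vector (x1, y1) is a multiple of its quarter turn (-y1, x1), and
    the factor is their determinant. *)
Lemma planar_frenet (x1 y1 x2 y2 : R) :
  x1 ^+ 2 + y1 ^+ 2 = 1 -> x1 * x2 + y1 * y2 = 0 ->
  x2 = - (x1 * y2 - y1 * x2) * y1 /\ y2 = (x1 * y2 - y1 * x2) * x1.
Proof.
move=> U orth; split.
  transitivity ((x1 ^+ 2 + y1 ^+ 2) * x2 - x1 * (x1 * x2 + y1 * y2)).
    by rewrite U orth; ring.
  ring.
transitivity ((x1 ^+ 2 + y1 ^+ 2) * y2 - y1 * (x1 * x2 + y1 * y2)).
  by rewrite U orth; ring.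
ring.
Qed.

(** Two planar vectors turning at the same speed keep their lengths and the angle between them. *)
Lemma rotating_pair_derive (x1 y1 x2 y2 : R -> R) (k t : R) :
  is_derive t 1 x1 (- k * y1 t) -> is_derive t 1 y1 (k * x1 t) ->
  is_derive t 1 x2 (- k * y2 t) -> is_derive t 1 y2 (k * x2 t) ->
  is_derive t 1 (fun t => x1 t * x2 t + y1 t * y2 t) 0 /\
  is_derive t 1 (fun t => x1 t * y2 t - y1 t * x2 t) 0.
Proof.
move=> dx1 dy1 dx2 dy2; split.
  apply: is_derive_eq.
  rewrite /GRing.scale/=; ring.
apply: is_derive_eq.
rewrite /GRing.scale/=; ring.
Qed.

(** [C] and [S] are the coordinates of (c, d) in the orthonormal basis (a, b), (-b, a). *)
Lemma unit_vector_coords (a b c d C S : R) : a ^+ 2 + b ^+ 2 = 1 ->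
  a * c + b * d = C -> a * d - b * c = S ->
  c = C * a - S * b /\ d = S * a + C * b.
Proof.
by move=> U <- <-; split; rewrite -[LHS]mul1r -U; ring.
Qed.

Lemma dot_det_sqr (a b c d : R) : a ^+ 2 + b ^+ 2 = 1 -> c ^+ 2 + d ^+ 2 = 1 ->
  (a * c + b * d) ^+ 2 + (a * d - b * c) ^+ 2 = 1.
Proof.
move=> U V; transitivity ((a ^+ 2 + b ^+ 2) * (c ^+ 2 + d ^+ 2)); first ring.
by rewrite U V mulr1.
Qed.

(** Compares the z-velocities of the two curves: the form y dx - x dy is invariant under the
    rotation, and the translation adds only the terms in [A] and [B]. *)
Lemma motion_horizontal (C S A B a b p q : R) : C ^+ 2 + S ^+ 2 = 1 ->
  (S * p + C * q + B) * (C * a - S * b) - (C * p - S * q + A) * (S * a + C * b) =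
  q * a - p * b + (B * (C * a - S * b) - A * (S * a + C * b)).
Proof.
move=> CS; rewrite -[q * a - p * b]mul1r -CS; ring.
Qed.

End PlaneRotations.

(** * Frenet equations, congruence and existence of curves *)

Section Curves.
Context {R : realType} (I : set R) (I_open : open I) (I_interval : is_interval I).

(** [J0] takes values in the contact plane, so the [T] part of the metric drops out and a planar
    determinant remains. *)
Lemma p_curvatureE (c : R -> 'rV[R]_3) s :
  p_curvature c s = cx (derive1 c s) * cy (derive1 (derive1 c) s) -
                    cy (derive1 c s) * cx (derive1 (derive1 c) s).
Proof. rewrite /p_curvature J0E /metric /theta0 !vec3E.
move: (derive1 c s) (derive1 (derive1 c) s) (c s) => a b p; ring. Qed.

Lemma horizontal_mnorm (p v : 'rV[R]_3) : in_xi0 p v ->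
  mnorm p v = Num.sqrt (cx v ^+ 2 + cy v ^+ 2).
Proof. by rewrite /mnorm /metric => ->; rewrite mul0r addr0 !expr2. Qed.

Section Frenet.
Variables (c : R -> 'rV[R]_3) (c_hus : horizontal_unit_speed_curve I c).

Lemma curve_is_derive s i : I s ->
  is_derive s 1 (fun t => c t ord0 i) (derive1 c s ord0 i).
Proof.
by move=> Is; have [cs _ _] := c_hus; apply: is_derive_coord; exact: (cs 0%N).
Qed.

Lemma curve_is_derive2 s i : I s ->
  is_derive s 1 (fun t => derive1 c t ord0 i) (derive1 (derive1 c) s ord0 i).
Proof.
by move=> Is; have [cs _ _] := c_hus; apply: is_derive_coord; exact: (cs 1%N).
Qed.

Lemma unit_speed_sqr s : I s -> cx (derive1 c s) ^+ 2 + cy (derive1 c s) ^+ 2 = 1.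
Proof.
move=> Is; have [_ ch cu] := c_hus.
have := cu s Is; rewrite horizontal_mnorm; last exact: ch.
move=> /(congr1 (fun x => x ^+ 2)).
by rewrite sqr_sqrtr ?expr1n// addr_ge0 ?sqr_ge0.
Qed.

Lemma horizontal_cz s : I s ->
  cz (derive1 c s) = cy (c s) * cx (derive1 c s) - cx (c s) * cy (derive1 c s).
Proof.
move=> Is; have [_ ch _] := c_hus; have := ch s Is.
rewrite /in_xi0 /theta0; lra.
Qed.

Lemma unit_speed_orthogonal s : I s ->
  cx (derive1 c s) * cx (derive1 (derive1 c) s) +
  cy (derive1 c s) * cy (derive1 (derive1 c) s) = 0.
Proof.
move=> Is.
pose q t := cx (derive1 c t) * cx (derive1 c t) +
            cy (derive1 c t) * cy (derive1 c t).
(* [q] is the squared planar speed, equal to 1 near [s]; the product rule then makes twice the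
   wanted dot product vanish. *)
have [_ q0] : is_derive s 1 q 0.
  apply: near_eq_is_derive (is_derive_cst (1 : R) s 1).
  apply: filterS (open_near I I_open s Is) => t It.
  by rewrite /q -!expr2 unit_speed_sqr.
have d2 i := curve_is_derive2 s i Is.
have [_] := is_deriveD (is_deriveM (d2 (@Ordinal 3 0 isT)) (d2 (@Ordinal 3 0 isT)))
  (is_deriveM (d2 (@Ordinal 3 1 isT)) (d2 (@Ordinal 3 1 isT))).
rewrite -[X in X = _]/('D_1 q s) q0.
move=> /esym; rewrite -!mulr2n -mulrnDl => /eqP.
by rewrite mulrn_eq0/= => /eqP.
Qed.

Lemma frenet s : I s ->
  is_derive s 1 (fun t => cx (derive1 c t)) (- p_curvature c s * cy (derive1 c s)) /\
  is_derive s 1 (fun t => cy (derive1 c t)) (p_curvature c s * cx (derive1 c s)).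
Proof.
move=> Is; rewrite p_curvatureE.
have [<- <-] := planar_frenet _ _ _ _ (unit_speed_sqr s Is) (unit_speed_orthogonal s Is).
by split; exact: curve_is_derive2.
Qed.

End Frenet.

Lemma congruent_of_eq_p_curvature (c1 c2 : R -> 'rV[R]_3) :
  horizontal_unit_speed_curve I c1 -> horizontal_unit_speed_curve I c2 ->
  (forall s, I s -> p_curvature c1 s = p_curvature c2 s) ->
  exists g : 'rV[R]_3 -> 'rV[R]_3,
    PSH1 g /\ (forall s, I s -> c2 s = g (c1 s)).
Proof.
(* For an empty [I] the identity motion serves. *)
move=> h1 h2 keq; have [[s0 Is0]|I0] := pselect (exists s, I s); last first.
  exists (motion 1 0 0 0 0); split=> [|s Is]; last by case: I0; exists s.
  by apply: motion_PSH1; rewrite expr1n expr0n addr0.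
pose x1 t := cx (derive1 c1 t); pose y1 t := cy (derive1 c1 t).
pose x2 t := cx (derive1 c2 t); pose y2 t := cy (derive1 c2 t).
have dot_det t It := rotating_pair_derive x1 y1 x2 y2 (p_curvature c1 t) t
  (frenet c1 h1 t It).1 (frenet c1 h1 t It).2.
(* Equal curvatures allow the Frenet equations of [c2] to be written with the curvature of [c1]. *)
have {}dot_det t : I t -> is_derive t 1 (fun t => x1 t * x2 t + y1 t * y2 t) 0 /\
    is_derive t 1 (fun t => x1 t * y2 t - y1 t * x2 t) 0.
  move=> It; have [F2x F2y] := frenet c2 h2 t It.
  by move: F2x F2y; rewrite -(keq t It); exact: (dot_det t It).
pose C := x1 s0 * x2 s0 + y1 s0 * y2 s0.
pose S := x1 s0 * y2 s0 - y1 s0 * x2 s0.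
have Ccst s : I s -> x1 s * x2 s + y1 s * y2 s = C.
  move=> Is; exact: (derive0_cst_on I I_interval _ (fun t It => (dot_det t It).1)).
have Scst s : I s -> x1 s * y2 s - y1 s * x2 s = S.
  move=> Is; exact: (derive0_cst_on I I_interval _ (fun t It => (dot_det t It).2)).
have U1 s Is : x1 s ^+ 2 + y1 s ^+ 2 = 1 := unit_speed_sqr c1 h1 s Is.
have U2 s Is : x2 s ^+ 2 + y2 s ^+ 2 = 1 := unit_speed_sqr c2 h2 s Is.
have CS : C ^+ 2 + S ^+ 2 = 1 := dot_det_sqr _ _ _ _ (U1 s0 Is0) (U2 s0 Is0).
have xy2 s Is := unit_vector_coords _ _ _ _ _ _ (U1 s Is) (Ccst s Is) (Scst s Is).
have x2E s : I s -> x2 s = C * x1 s - S * y1 s by move=> /xy2[].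
have y2E s : I s -> y2 s = S * x1 s + C * y1 s by move=> /xy2[].
have z1E s : I s -> cz (derive1 c1 s) = cy (c1 s) * x1 s - cx (c1 s) * y1 s.
  exact: horizontal_cz.
have z2E s : I s -> cz (derive1 c2 s) = cy (c2 s) * x2 s - cx (c2 s) * y2 s.
  exact: horizontal_cz.
have e1 s i Is := curve_is_derive c1 h1 s i Is.
have e2 s i Is := curve_is_derive c2 h2 s i Is.
(* [X] and [Y] are the planar coordinates of the rotated first curve. *)
pose X t := C * cx (c1 t) - S * cy (c1 t).
pose Y t := S * cx (c1 t) + C * cy (c1 t).
have dX s : I s -> is_derive s 1 X (C * x1 s - S * y1 s).
  by move=> Is; apply: is_deriveB; apply: is_deriveZ; exact: e1.
have dY s : I s -> is_derive s 1 Y (S * x1 s + C * y1 s).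
  by move=> Is; apply: is_deriveD; apply: is_deriveZ; exact: e1.
(* The translation is chosen to make the curves meet at [s0]; equal derivatives then make them agree
   on all of [I]. *)
pose A := cx (c2 s0) - X s0; pose B := cy (c2 s0) - Y s0.
have XA s : I s -> cx (c2 s) = X s + A.
  move=> Is; suff : cx (c2 s) - X s = A by move=> <-; ring.
  apply: (eq_derive_on I I_interval _ _ x2 _ _ dX) => // t It; exact: e2.
have YB s : I s -> cy (c2 s) = Y s + B.
  move=> Is; suff : cy (c2 s) - Y s = B by move=> <-; ring.
  apply: (eq_derive_on I I_interval _ _ y2 _ _ dY) => // t It; exact: e2.
(* The z-coordinate of the moved first curve, up to the constant [D] still to be fixed. *)
pose Z t := cz (c1 t) + (B * X t - A * Y t).
have dZ s : I s -> is_derive s 1 Z (cz (derive1 c1 s) +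
    (B * (C * x1 s - S * y1 s) - A * (S * x1 s + C * y1 s))).
  move=> Is; apply: is_deriveD; first exact: e1.
  by apply: is_deriveB; apply: is_deriveZ; [exact: dX|exact: dY].
pose D := cz (c2 s0) - Z s0.
have ZD s : I s -> cz (c2 s) = Z s + D.
  move=> Is; suff : cz (c2 s) - Z s = D by move=> <-; ring.
  apply: (eq_derive_on I I_interval _ _ (fun t => cz (derive1 c2 t)) _ _ dZ)
    => // t It.
  rewrite (z1E t It) (z2E t It) (XA t It) (YB t It) (x2E t It) (y2E t It).
  exact: motion_horizontal.
exists (motion C S A B D); split=> [|s Is]; first exact: motion_PSH1.
rewrite -[LHS]vec3_coords XA// YB// ZD// /motion -/(X s) -/(Y s) /Z.
by congr vec3; ring.
Qed.

Lemma exists_curve_p_curvature (k : R -> R) : smooth_on I k ->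
  exists gamma : R -> 'rV[R]_3,
    horizontal_unit_speed_curve I gamma /\
    (forall s, I s -> p_curvature gamma s = k s).
Proof.
have prim (f : R -> R) : smooth_on I f ->
    exists F, (forall s, I s -> is_derive s 1 F (f s)) /\ smooth_on I F.
  move=> fs; have [s Is|F dF] := exists_primitive_on I I_open I_interval f.
    apply: differentiable_continuous; apply/derivable1_diffP; exact: (fs 0%N).
  by exists F; split; [exact: dF|exact: (smooth_on_derive I I_open F f dF fs)].
(* [th] is the angle of the planar velocity, whose rate of change is the curvature. *)
move=> ks; have [th [dth ths]] := prim k ks.
have [cs ss] := smooth_on_cos_sin I I_open th ths.
have [x [dx xs]] := prim _ cs; have [y [dy ys]] := prim _ ss.
(* The value y x' - x y' of z' dictated by horizontality. *)
pose dz t := y t * cos (th t) + - (x t * sin (th t)).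
have dzs : smooth_on I dz.
  exact: (smooth_onD I I_open _ _ (smooth_onM I I_open _ _ ys cs)
    (smooth_onN I I_open _ (smooth_onM I I_open _ _ xs ss))).
have [z [dzE zs]] := prim _ dzs.
pose c t := vec3 (x t) (y t) (z t).
have c1 s : I s -> derive1 c s = vec3 (cos (th s)) (sin (th s)) (dz s).
  move=> Is; apply: derive1_vec3; [exact: dx|exact: dy|exact: dzE].
exists c; split; first split.
- exact: (smooth_on_vec3 _ _ _ _ I_open xs ys zs).
- by move=> s Is; rewrite /in_xi0 /theta0 c1// /c !vec3E /dz; ring.
- move=> s Is; rewrite horizontal_mnorm ?c1//.
    by rewrite !vec3E cos2Dsin2 sqrtr1.
  by rewrite /in_xi0 /theta0 /c !vec3E /dz; ring.
move=> s Is; rewrite p_curvatureE.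
have ddz := derivable_is_derive1 _ s (dzs 0%N s Is).
(* The velocity formula [c1] holds on [I], and openness of [I] allows it to be differentiated at
   [s]. *)
rewrite (eq_on_derive1 I I_open _ (derive1 c)
  (fun t => vec3 (cos (th t)) (sin (th t)) (dz t)))//.
rewrite (derive1_vec3 _ _ _ s _ _ _ (is_derive_cos_comp _ _ _ (dth s Is))
  (is_derive_sin_comp _ _ _ (dth s Is)) ddz) c1// !vec3E.
transitivity (k s * (cos (th s) ^+ 2 + sin (th s) ^+ 2)); first ring.
by rewrite cos2Dsin2 mulr1.
Qed.

End Curves.

Theorem corollary1p3 (R : realType) (I : set R)
    (I_open : open I) (I_interval : is_interval I) :
  (forall gamma1 gamma2 : R -> 'rV[R]_3,
     horizontal_unit_speed_curve I gamma1 ->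
     horizontal_unit_speed_curve I gamma2 ->
     (forall s, I s -> p_curvature gamma1 s = p_curvature gamma2 s) ->
     exists g : 'rV[R]_3 -> 'rV[R]_3,
       PSH1 g /\ (forall s, I s -> gamma2 s = g (gamma1 s)))
  /\
  (forall k : R -> R, smooth_on I k ->
     exists gamma : R -> 'rV[R]_3,
       horizontal_unit_speed_curve I gamma /\
       (forall s, I s -> p_curvature gamma s = k s)).
Proof.
split=> [c1 c2 h1 h2 keq|k ks].
- exact: (congruent_of_eq_p_curvature I I_open I_interval c1 c2 h1 h2 keq).
- exact: (exists_curve_p_curvature I I_open I_interval k ks).
Qed.
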